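(* Let $K$ be a valued field with absolute value $|\cdot|$, and let $(X,f)$ be a degree $d$ polarized dynamical system over $K$ with $\dim(X)>0$: that is, there are a polarized dynamical system $\phi:X\to X$, an embedding $\iota:X\hookrightarrow\mathbb{P}^N$, and a morphism $f:\mathbb{P}^N\to\mathbb{P}^N$ of degree $d\ge 2$, all defined over $K$, with $f\circ\iota=\iota\circ\phi$. Let $F:\mathbb{A}_K^{N+1}\to\mathbb{A}_K^{N+1}$ be a homogeneous lift of $f$, and let $\mathcal{K}$ be its homogeneous filled Julia set. For this $F$, and for $n\in\mathbb{Z}_+$, let $c(n)=\dim H^0(X,\iota^*(\mathcal{O}(n)))$ and let $H(n)$ be a special basis of $H^0(X,\iota^*(\mathcal{O}(n)))$ with respect to $(X,f)$ and the lift $F$ (as defined in the context). Let $\pi:\mathbb{A}^{N+1}\setminus\{(0,\dots,0)\}\to\mathbb{P}^N$ be the natural projection, and let $R$ be the diameter of $\mathcal{K}\cap\pi^{-1}(X)$ with respect to the distance defined by the sup-norm. Then there is a constant $C=C(d,N)$ with the following property. For any $n\ge 2$ and any $c(n)$-tuple $\vec{P}=(P_1,\dots,P_{c(n)})$ of points in $\mathcal{K}\cap\pi^{-1}(X)$, $$\log\left|\det\left(\eta_j(\vec{P})\right)_{\eta_j\in H(n)}\right|\le C\max\{\log R,1\}(\log n)\cdot c(n),$$ where $\log(0)$ is defined to be $-\infty$.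
   Context: A polarized dynamical system over $K$ is a triple $(X,\phi,\mathcal{L})$ with $X/K$ a projective variety, $\phi:X\to X$ an endomorphism, and $\mathcal{L}$ an ample line bundle on $X$ with $\phi^*(\mathcal{L})\cong\mathcal{L}^{d}$ for some integer $d\ge 2$. It extends to a degree $d$ morphism $f$ of some $\mathbb{P}^N$ via an embedding $\iota$, and one frames it as a pair $(X,f)$ with $X\subseteq\mathbb{P}^N$ (via $\iota$) a subvariety such that $f(X)\subseteq X$. A homogeneous lift of $f$ is a map $F=(F_0,\dots,F_N)$ with each $F_i\in K[x_0,\dots,x_N]$ homogeneous of degree $d$ and $f=[F_0:\cdots:F_N]$. With $\|(a_0,\dots,a_N)\|=\max_i|a_i|$, its homogeneous filled Julia set is $\mathcal{K}=\{P\in\mathbb{A}^{N+1}(K):\|F^k(P)\|\not\to\infty\text{ as }k\to\infty\}$, $F^k$ being the $k$-th iterate of $F$. Special basis $H(n)$. Write $F^{(k)}=(F^{(k)}_0,\dots,F^{(k)}_N)$ for the $k$-th iterate of $F$, and let $\mathcal{G}$ be the collection of polynomials of the form $\left(F_i^{(k)}\right)^j$ with $0\le i\le N$, $k\in\mathbb{Z}_+$, $1\le j\le d-1$. Let $\mathcal{G}^j=\{G_1G_2\cdots G_j: G_l\in\mathcal{G}\text{ for all }1\le l\le j\}$. For $n\ge d(N+1)$ let $t_1=\log_{\frac{N+1}{N}}(\max\{1,n-d(N+1)\})$, $t_2=\log_{\frac{2N+2}{2N+1}}n$, and $$\mathcal{F}=\bigcup_{j=\lfloor t_1\rfloor}^{\lfloor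 t_2\rfloor}\left\{\eta G: G\in\mathcal{G}^j\text{ and }\eta\text{ homogeneous of degree}<d(N+1)\right\},$$ where $\eta\in K[x_0,\dots,x_N]$. The degree $n$ elements of $\mathcal{F}$ span $H^0(X,\iota^*(\mathcal{O}(n)))$ over $K$. $H(n)$ denotes any basis of $H^0(X,\iota^*(\mathcal{O}(n)))$ consisting of (the sections given by) degree $n$ elements of $\mathcal{F}$ whenever $n\ge d(N+1)$, and consisting of the standard monomial basis otherwise. $\left(\eta_j(\vec{P})\right)_{\eta_j\in H(n)}$ denotes the $c(n)\times c(n)$ matrix whose $i$-th row corresponds to $P_i$ and whose $j$-th column corresponds to $\eta_j\in H(n)$, i.e. with $(i,j)$ entry $\eta_j(P_i)$.
   Formalization: The homogeneous factors η in the special basis H(n) are required to have all coefficients of absolute value at most 1; without a normalization the claim fails, since scaling one basis element by a large constant makes the determinant arbitrarily large. *)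

(* Defs.v *)
(* mpoly has to come before the analysis files: the opposite order is rejected
   because of incompatible notation levels. *)
From mathcomp Require Import all_boot all_order all_algebra.
From mathcomp Require Import mpoly.
From mathcomp Require Import boolp classical_sets reals ereal.
From mathcomp Require Import topology normedtype sequences exp.

Set Implicit Arguments.
Unset Strict Implicit.
Unset Printing Implicit Defensive.

Import Order.TTheory GRing.Theory Num.Theory.
Import numFieldNormedType.Exports.

Local Open Scope classical_set_scope.
Local Open Scope ring_scope.

Definition absolute_value (R : realType) (K : fieldType) (v : K -> R) : Prop :=
  [/\ forall x, 0 <= v x,
      forall x, v x = 0 <-> x = 0,
      forall x y, v (x * y) = v x * v y
    & forall x y, v (x + y) <= v x + v y].

Definition supnorm (R : realType) (K : fieldType) (v : K -> R) (n : nat)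
    (P : 'I_n -> K) : R :=
  \big[Num.max/0]_(i < n) v (P i).

(* An extended real: -oo on the empty set, +oo on unbounded sets. *)
Definition diameter (R : realType) (K : fieldType) (v : K -> R) (n : nat)
    (A : set ('I_n -> K)) : \bar R :=
  ereal_sup [set (supnorm v (fun i => P i - Q i))%:E | P in A & Q in A].

Definition log_base (R : realType) (b x : R) : R := ln x / ln b.

Section Projective.
Variables (K : fieldType) (N : nat).

Notation poly_ring := {mpoly K[N.+1]}.
Implicit Type I : {pred poly_ring}.

(* The integral closed subschemes of P^N over K are represented by their
   homogeneous prime ideals not containing (x_0, ..., x_N). *)
Definition proj_variety I : Prop :=
  [/\ idealr_closed I, prime_idealr_closed I,
      forall p k, p \in I -> pihomog mdeg k p \in I
    & exists i, 'X_i \notin I].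

(* Existence of a chain Z_k < ... < Z_0 <= X of irreducible closed subsets. *)
Definition proj_dim_ge I (k : nat) : Prop :=
  exists J : nat -> {pred poly_ring},
    [/\ forall l, (l <= k)%N -> proj_variety (J l),
        {subset I <= J 0%N}
      & forall l, (l < k)%N ->
          {subset J l <= J l.+1} /\ ~ {subset J l.+1 <= J l}].

(* The preimage of X(L) in A^{N+1}(L) minus the origin, for g : K -> L. *)
Definition punctured_cone I (L : fieldType) (g : {rmorphism K -> L}) :
    set ('I_N.+1 -> L) :=
  [set P | (exists i, P i != 0) /\
           forall p, p \in I -> (map_mpoly g p).@[P] = 0].

Variable F : (N.+1).-tuple poly_ring.

Definition aff_map (L : fieldType) (g : {rmorphism K -> L})
    (P : 'I_N.+1 -> L) : 'I_N.+1 -> L :=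
  fun i => (map_mpoly g (tnth F i)).@[P].

(* [F_0 : ... : F_N] is a morphism when the F_i have no common zero other than
   the origin over any extension of K (K itself need not be closed). *)
Definition homogeneous_lift (d : nat) : Prop :=
  (forall i, tnth F i \is d.-homog) /\
  forall (L : fieldType) (g : {rmorphism K -> L}) (P : 'I_N.+1 -> L),
    (forall i, aff_map g P i = 0) -> forall i, P i = 0.

(* f(X) is contained in X, tested on points over all extensions of K. *)
Definition maps_into_itself I : Prop :=
  forall (L : fieldType) (g : {rmorphism K -> L}) (P : 'I_N.+1 -> L),
    punctured_cone I g P -> punctured_cone I g (aff_map g P).

(* The choice of O(1) on X gives L with phi^* L = L^d. *)
Definition polarized_system (d : nat) I : Prop :=
  [/\ proj_variety I, homogeneous_lift d & maps_into_itself I].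

(* The family num i / x_i^den, over the cover of X by the opens x_i <> 0. *)
Record local_sections := LocalSections
  { den : nat; num : 'I_N.+1 -> poly_ring }.

(* H^0(X, O(n)): each num i / x_i^den lies in the degree n part of S_{x_i},
   S := K[x]/I, and the i-th and j-th ones agree in S_{x_i x_j}. *)
Definition global_section I (n : nat) (s : local_sections) : Prop :=
  (forall i, num s i \is (n + den s).-homog) /\
  (forall i j, exists e,
     ('X_i * 'X_j) ^+ e *
     ('X_j ^+ den s * num s i - 'X_i ^+ den s * num s j) \in I).

Definition section_eq I (s t : local_sections) : Prop :=
  forall i, exists e,
    'X_i ^+ e * ('X_i ^+ den t * num s i - 'X_i ^+ den s * num t i) \in I.

Definition poly_section (p : poly_ring) : local_sections :=
  LocalSections 0 (fun=> p).

(* The sections given by H form a K-basis of H^0(X, O(n)); in particular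
   c is the dimension of that space. *)
Definition basis_H0 I (n c : nat) (H : 'I_c -> poly_ring) : Prop :=
  [/\ forall j, H j \is n.-homog,
      forall a : 'I_c -> K,
        section_eq I (poly_section (\sum_(j < c) a j *: H j))
                     (poly_section 0) ->
        forall j, a j = 0
    & forall s, global_section I n s ->
        exists a : 'I_c -> K,
          section_eq I s (poly_section (\sum_(j < c) a j *: H j))].

Fixpoint lift_iter (k : nat) : (N.+1).-tuple poly_ring :=
  if k is k'.+1 then [tuple tnth F i \mPo lift_iter k' | i < N.+1]
  else [tuple 'X_i | i < N.+1].

Definition gens (d : nat) : set poly_ring :=
  [set G | exists (i : 'I_N.+1) (k e : nat),
     [/\ (0 < k)%N, (1 <= e <= d.-1)%N & G = tnth (lift_iter k) i ^+ e]].

Definition gen_products (d j : nat) : set poly_ring :=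
  [set p | exists G : 'I_j -> poly_ring,
     (forall l, gens d (G l)) /\ p = \prod_(l < j) G l].

Variables (R : realType) (v : K -> R).

Definition filled_julia : set ('I_N.+1 -> K) :=
  [set P | ~ (supnorm v (iter k (aff_map idfun) P) @[k --> \oo] --> +oo)].

(* The coefficients of eta are normalized to have absolute value at most 1.
   Multiplying an element of a basis by a constant multiplies the determinant
   of the evaluation matrix by it, so a bound on that determinant requires the
   scale of the basis elements to be fixed. *)
Definition special_family (d n : nat) : set poly_ring :=
  let t1 : R := log_base (N.+1%:R / N%:R) (maxn 1 (n - d * N.+1))%:R in
  let t2 : R := log_base ((2 * N + 2)%:R / (2 * N + 1)%:R) n%:R in
  [set p | exists (j e : nat) (eta G : poly_ring),
     [/\ Num.floor t1 <= j%:Z <= Num.floor t2,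
         gen_products d j G,
         (e < d * N.+1)%N /\ eta \is e.-homog,
         (forall m, v eta@_m <= 1)
       & p = eta * G]].

Definition special_basis I (d n c : nat) (H : 'I_c -> poly_ring) : Prop :=
  basis_H0 I n H /\
  if (d * N.+1 <= n)%N then forall j, special_family d n (H j)
  else forall j, exists2 m : 'X_{1..N.+1}, mdeg m = n & H j = 'X_[m].

End Projective.

(* Main.v *)
Require Import Defs.
From mathcomp Require Import all_boot all_order all_algebra.
From mathcomp Require Import perm lra.
From mathcomp Require Import mpoly.
From mathcomp Require Import boolp classical_sets reals ereal.
From mathcomp Require Import topology normedtype sequences exp.

Set Implicit Arguments.
Unset Strict Implicit.
Unset Printing Implicit Defensive.

Import Order.TTheory GRing.Theory Num.Theory.
Import numFieldNormedType.Exports.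

Local Open Scope classical_set_scope.
Local Open Scope ring_scope.

(** The determinant is a sum of at most c ^ c signed products of c values of
basis elements, so it suffices that each value [(H j).@[P i]] is at most
[A * B ^+ E] with A depending on d and N only, B = max(1, R), and
E = O(log n): then log |det| <= c (log c + log A + E log B), where
log c = O(log n) because c is the dimension of a space spanned by independent
forms of degree n in N + 1 variables ([free_forms_leq]).

The bound on the values rests on two facts.

- For n >= d (N + 1) an element of the special basis is eta * G with eta a form of bounded degree
  and coefficients of absolute value at most 1, and G a product of at most
  t2 = O(log n) powers, with exponents less than d, of coordinates of iterates
  of F.  The degree of G is of order n, but at a point P of the filled Julia
  set this is harmless: the i-th coordinate of the k-th iterate of F takes at P
  the value of the i-th coordinate of the point F^k(P), which again lies in the
  filled Julia set and over X ([julia_cone_iter]).  Hence only the number of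
  factors of G matters ([gen_products_absv_le], [special_basis_absv_le]).

- Every coordinate of a point P of the filled Julia set over X is at most
  max(1, R) ([julia_cone_absv_le]).  This set is stable under multiplication
  by nonzero t with |t| <= 1, because F is homogeneous and X is a cone; so if
  the absolute value is nontrivial the distance from P to the points t^k P,
  with |t| < 1, tends to the norm of P and is at most R.  If the absolute
  value is bounded by 1 there is nothing to prove. *)

(** * Estimates for an absolute value *)

Section AbsoluteValue.
Context (R : realType) (K : fieldType) (v : K -> R) (av : absolute_value v).

Lemma absv_ge0 x : 0 <= v x. Proof. by case: av. Qed.

Lemma absvM x y : v (x * y) = v x * v y. Proof. by case: av. Qed.

Lemma absvD x y : v (x + y) <= v x + v y. Proof. by case: av. Qed.

Lemma absv_eq0 x : (v x == 0) = (x == 0).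
Proof. by case: av => _ /(_ x) e _ _; apply/eqP/eqP => /e. Qed.

Lemma absv0 : v 0 = 0. Proof. by apply/eqP; rewrite absv_eq0. Qed.

Lemma absv1 : v 1 = 1.
Proof.
have v1 : v 1 != 0 by rewrite absv_eq0 oner_neq0.
by apply: (mulfI v1); rewrite -absvM !mulr1.
Qed.

Lemma absvX x k : v (x ^+ k) = v x ^+ k.
Proof. by elim: k => [|k ih]; rewrite ?expr0 ?absv1// !exprS absvM ih. Qed.

Lemma absvV x : x != 0 -> v x^-1 = (v x)^-1.
Proof.
move=> x0; have vx0 : v x != 0 by rewrite absv_eq0.
by apply: (mulfI vx0); rewrite -absvM !mulfV// absv1.
Qed.

Lemma absv_sign k : v ((-1) ^+ k) = 1.
Proof.
rewrite absvX; suff -> : v (-1) = 1 by rewrite expr1n.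
apply/eqP; rewrite -(@eqrXn2 _ 2) ?absv_ge0 ?ler01//.
by rewrite -absvX sqrrN !expr1n absv1.
Qed.

Lemma absv_prod (J : Type) (s : seq J) (Q : pred J) (f : J -> K) :
  v (\prod_(i <- s | Q i) f i) = \prod_(i <- s | Q i) v (f i).
Proof. exact: (big_morph v absvM absv1). Qed.

Lemma absv_sum (J : Type) (s : seq J) (Q : pred J) (f : J -> K) :
  v (\sum_(i <- s | Q i) f i) <= \sum_(i <- s | Q i) v (f i).
Proof.
elim/big_rec2: _ => [|i y z _ le_zy]; first by rewrite absv0.
by apply: le_trans (absvD _ _) _; rewrite lerD2l.
Qed.

(** The number c ^ c stands for the number c! of permutations, as permutations
inject into all self-maps; log (c ^ c) = c log c is what is needed later. *)
Lemma absv_det_le c (A : 'M[K]_c) (B : R) :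
  0 <= B -> (forall i j, v (A i j) <= B) -> v (\det A) <= (c ^ c)%N%:R * B ^+ c.
Proof.
move=> B0 A_le; rewrite /determinant.
apply: (@le_trans _ _ (#|{perm 'I_c}|%:R * B ^+ c)).
  apply: le_trans (absv_sum _ _ _) _.
  rewrite mulr_natl -sumr_const; apply: ler_sum => s _.
  rewrite absvM absv_sign mul1r absv_prod -[in leRHS](card_ord c) -prodr_const.
  by apply: ler_prod => i _; rewrite absv_ge0 A_le.
rewrite ler_wpM2r ?exprn_ge0// ler_nat.
have := leq_card (fun s : {perm 'I_c} => pval s) val_inj.
by rewrite card_ffun !card_ord.
Qed.

Lemma absv_monomial_le n (m : 'X_{1..n}) (P : 'I_n -> K) (B : R) :
  (forall i, v (P i) <= B) -> v ('X_[m]).@[P] <= B ^+ mdeg m.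
Proof.
move=> P_le; rewrite mevalX absv_prod mdegE -prodrXr.
apply: ler_prod => i _; rewrite absvX exprn_ge0 ?absv_ge0//=.
by rewrite lerXn2r ?nnegrE ?absv_ge0// (le_trans (absv_ge0 _) (P_le i)).
Qed.

End AbsoluteValue.

(** * Homogeneous forms *)

Section HomogeneousForms.
Context (K : fieldType) (n : nat).

(** Each exponent of a multinomial of degree at most e is at most e, which embeds
s into the maps from n points to e + 1 points.  This crude count serves both
for the number of terms of a form and for the dimension of a space of forms. *)
Lemma size_multinoms (s : seq 'X_{1..n}) e :
  uniq s -> (forall m, m \in s -> (mdeg m <= e)%N) ->
  (size s <= e.+1 ^ n)%N.
Proof.
move=> s_uniq s_le.
pose f (m : 'X_{1..n}) : {ffun 'I_n -> 'I_e.+1} := [ffun i => inord (m i)].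
have f_inj : {in s &, injective f}.
  move=> m1 m2 m1s m2s /ffunP f12; apply/mnmP => i.
  have m_lt m : m \in s -> (m i < e.+1)%N.
    move=> /s_le; rewrite ltnS; apply: leq_trans.
    by rewrite mdegE (bigD1 i)//= leq_addr.
  have := congr1 val (f12 i).
  by rewrite !ffunE /= !inordK ?m_lt.
rewrite -(size_map f) -[leqRHS](_ : #|{ffun 'I_n -> 'I_e.+1}| = _);
  last by rewrite card_ffun !card_ord.
rewrite -(card_uniqP _) ?max_card//.
by rewrite map_inj_in_uniq.
Qed.

(** The coefficient matrix of H, with columns indexed by the monomials that occur,
is row free, so it has no more rows than columns. *)
Lemma free_forms_leq c e (H : 'I_c -> {mpoly K[n]}) :
  (forall j, H j \is e.-homog) ->
  (forall a : 'I_c -> K, \sum_(j < c) a j *: H j = 0 -> forall j, a j = 0) ->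
  (c <= e.+1 ^ n)%N.
Proof.
move=> H_homog H_free.
pose s := undup (flatten [seq (msupp (H j) : seq _) | j <- enum 'I_c]).
have mem_s m j : m \in msupp (H j) -> m \in s.
  move=> mj; rewrite mem_undup; apply/flattenP.
  by exists (msupp (H j)) => //; apply: map_f; rewrite mem_enum.
have s_le m : m \in s -> (mdeg m <= e)%N.
  rewrite mem_undup => /flattenP[_ /mapP[j _ ->]].
  by move/(dhomogP mdeg e (H j) (H_homog j)) => ->.
apply: leq_trans (size_multinoms (undup_uniq _) s_le).
pose A := \matrix_(j < c, k < size s) (H j)@_(nth 0%MM s k).
suff /eqP rank_A : row_free A.
  by rewrite -[leqLHS]rank_A; exact: rank_leq_col.
apply: inj_row_free => u uA0; apply/rowP => j; rewrite mxE.
apply: (H_free (fun j => u 0 j)); apply/mpolyP => m.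
rewrite mcoeff0 raddf_sum /=.
have [ms|ms] := boolP (m \in s); last first.
  rewrite big1// => i _; rewrite mcoeffZ memN_msupp_eq0 ?mulr0//.
  by apply: contra ms; exact: mem_s.
have lt_ms : (index m s < size s)%N by rewrite index_mem.
have /rowP /(_ (Ordinal lt_ms)) := uA0; rewrite !mxE => uA0m.
rewrite -[RHS]uA0m; apply: eq_bigr => i _.
by rewrite mcoeffZ mxE /= nth_index.
Qed.

Lemma meval_homogZ e (p : {mpoly K[n]}) (t : K) (P : 'I_n -> K) :
  p \is e.-homog -> p.@[fun i => t * P i] = t ^+ e * p.@[P].
Proof.
move=> /dhomogP p_homog; rewrite !mevalE mulr_sumr.
rewrite big_seq [RHS]big_seq; apply: eq_bigr => m mp.
rewrite mulrCA; congr (_ * _); rewrite -(p_homog m mp) /= mdegE -prodrXr.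
by rewrite -big_split /=; apply: eq_bigr => i _; rewrite exprMn.
Qed.

Lemma absv_form_le (R : realType) (v : K -> R) e (p : {mpoly K[n]})
    (P : 'I_n -> K) (B : R) :
  absolute_value v -> 0 <= B -> p \is e.-homog -> (forall m, v p@_m <= 1) ->
  (forall i, v (P i) <= B) -> v p.@[P] <= (e.+1 ^ n)%N%:R * B ^+ e.
Proof.
move=> av B0 /dhomogP p_homog p_le P_le.
have size_le : (size (msupp p) <= e.+1 ^ n)%N.
  by apply: size_multinoms => // m /p_homog <-.
apply: le_trans (_ : (size (msupp p))%:R * B ^+ e <= _); last first.
  by rewrite ler_wpM2r ?exprn_ge0// ler_nat.
rewrite mevalE; apply: le_trans (absv_sum av _ _ _) _.
rewrite mulr_natl -[size _]count_predT -iter_addr_0 -big_const_seq.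
rewrite big_seq [leRHS]big_seq; apply: ler_sum => m mp.
rewrite (absvM av) -[leRHS]mul1r ler_pM ?absv_ge0 ?p_le//.
rewrite -mevalX -(p_homog m mp); exact: absv_monomial_le.
Qed.

End HomogeneousForms.

(** * The filled Julia set over X *)

Section Dynamics.
Context (R : realType) (K : fieldType) (N d : nat) (v : K -> R).
Context (I : {pred {mpoly K[N.+1]}}) (F : (N.+1).-tuple {mpoly K[N.+1]}).
Context (av : absolute_value v) (psF : polarized_system F d I).

Local Notation julia_cone :=
  (filled_julia F v `&` punctured_cone I idfun).
Local Notation FK := (aff_map F (idfun : {rmorphism K -> K})).

Lemma map_mpoly_id n (p : {mpoly K[n]}) :
  map_mpoly (idfun : {rmorphism K -> K}) p = p.
Proof. by apply/mpolyP => m; rewrite mcoeff_map_mpoly. Qed.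

Lemma meval_lift_iter k i (P : 'I_N.+1 -> K) :
  (tnth (lift_iter F k) i).@[P] = iter k FK P i.
Proof.
elim: k i => [|k ih] i; first by rewrite /= tnth_mktuple mevalXU.
rewrite /= tnth_mktuple comp_mpoly_meval /aff_map map_mpoly_id.
by apply: meval_eq => j; exact: ih.
Qed.

Lemma iter_aff_mapZ k (t : K) (P : 'I_N.+1 -> K) :
  iter k FK (fun i => t * P i) = (fun i => t ^+ (d ^ k) * iter k FK P i).
Proof.
have [_ [F_homog _] _] := psF.
elim: k => [|k ih]; first by rewrite expn0 expr1.
rewrite /= ih; apply/funext => i; rewrite /aff_map !map_mpoly_id.
by rewrite (meval_homogZ _ _ (F_homog i)) -exprM -expnSr.
Qed.

Lemma supnorm_ge n (P : 'I_n -> K) i : v (P i) <= supnorm v P.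
Proof. exact: (le_bigmax 0 (fun i => v (P i)) i). Qed.

(** As F is homogeneous of degree d, passing from P to t P multiplies the norm of
the k-th iterate by |t| ^ (d ^ k) <= 1. *)
Lemma filled_juliaZ (t : K) (P : 'I_N.+1 -> K) :
  v t <= 1 -> filled_julia F v P -> filled_julia F v (fun i => t * P i).
Proof.
move=> t_le1 P_julia tP_to_oo; apply: P_julia.
apply: ger_cvgy tP_to_oo; near=> k; apply: le_bigmax2 => i _.
rewrite iter_aff_mapZ (absvM av) (absvX av).
by rewrite ler_piMl ?exprn_ile1 ?absv_ge0.
Unshelve. all: by end_near. Qed.

(** The ideal contains the homogeneous components of its elements, so each of
these components vanishes at P, hence at t P. *)
Lemma punctured_coneZ (t : K) (P : 'I_N.+1 -> K) : t != 0 ->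
  punctured_cone I (idfun : {rmorphism K -> K}) P ->
  punctured_cone I (idfun : {rmorphism K -> K}) (fun i => t * P i).
Proof.
have [[_ _ I_homog _] _ _] := psF.
move=> t0 [[i Pi0] P_van]; split; first by exists i; rewrite mulf_neq0.
move=> p pI; rewrite map_mpoly_id (pihomog_partitionE (leqnn (mmeasure mdeg p))).
rewrite raddf_sum big1//= => k _.
rewrite (meval_homogZ _ _ (pihomogP mdeg k p)).
by have := P_van _ (I_homog p k pI); rewrite map_mpoly_id => ->; rewrite mulr0.
Qed.

Lemma julia_cone_iter k (P : 'I_N.+1 -> K) :
  julia_cone P -> julia_cone (iter k FK P).
Proof.
have [_ _ F_I] := psF.
move=> P_jc; elim: k => [//|k [Q_julia Q_cone]]; split; last exact: F_I.
move: Q_julia; set Q := iter k FK P => Q_julia FQ_to_oo; apply: Q_julia.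
rewrite -cvg_shiftS; move: FQ_to_oo => /=; rewrite -/Q.
suff -> : (fun m => supnorm v (iter m FK (FK Q))) =
          (fun m => supnorm v (iter m.+1 FK Q)) by [].
by apply/funext => m; rewrite iterSr.
Qed.

(** The origin is not over X, so the norm of P is not itself a distance between two
points of the set; it is the limit of the distances from P to t ^ k P, where
|t| < 1.  The maximum with 1 covers the absolute values bounded by 1, for
which no such nonzero t need exist. *)
Lemma julia_cone_absv_le (r : R) (P : 'I_N.+1 -> K) i :
  diameter v julia_cone = r%:E -> julia_cone P -> v (P i) <= Num.max 1 r.
Proof.
move=> diam_r P_jc; rewrite le_max.
have [|/existsNP[x /negP]] := pselect (forall x, v x <= 1).
  by move=> /(_ (P i)) ->.
rewrite -ltNge => x_gt1; apply/orP; right.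
have x0 : x != 0 by rewrite -(absv_eq0 av) gt_eqF// (lt_trans ltr01).
pose t := x^-1; have t0 : t != 0 by rewrite invr_eq0.
have vt_lt1 : v t < 1 by rewrite (absvV av)// invf_lt1// (lt_trans ltr01).
have shrunk_le k : (1 - v t ^+ k) * v (P i) <= r.
  have tP_jc : julia_cone (fun i => t ^+ k * P i).
    split; last by apply: punctured_coneZ (P_jc.2); rewrite expf_neq0.
    apply: filled_juliaZ (P_jc.1).
    by rewrite (absvX av) exprn_ile1 ?absv_ge0// ltW.
  have : ((supnorm v (fun j => P j - t ^+ k * P j))%:E <= r%:E)%E.
    rewrite -diam_r; apply: ereal_sup_ubound.
    by exists P => //; exists (fun j => t ^+ k * P j).
  rewrite lee_fin; apply: le_trans; apply: le_trans (supnorm_ge _ i).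
  rewrite /= -[X in X - _ * _]mul1r -mulrBl (absvM av) ler_wpM2r ?absv_ge0//.
  rewrite lerBlDr -(absvX av) -[leLHS](absv1 av).
  by rewrite -[X in v X <= _](subrK (t ^+ k)) absvD.
have lim_shrunk : (1 - v t ^+ k) * v (P i) @[k --> \oo] --> (1 - 0) * v (P i).
  apply: cvgMl; apply: cvgB; first exact: cvg_cst.
  by apply: cvg_expr; rewrite ger0_norm ?absv_ge0.
rewrite -[v (P i)]mul1r -[X in X * _]subr0.
rewrite -(cvg_lim (@norm_hausdorff _ _) lim_shrunk).
by apply: limr_le; [apply/cvg_ex; eexists; exact: lim_shrunk | near=> k].
Unshelve. all: by end_near. Qed.

(** * Values of the special basis *)

(** The exponent does not involve the degree of G: each generator takes at P a
power of a coordinate of a point of the orbit of P. *)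
Lemma gen_products_absv_le (B : R) j (G : {mpoly K[N.+1]}) P :
  1 <= B -> (forall k i, v (iter k FK P i) <= B) -> gen_products F d j G ->
  v G.@[P] <= B ^+ (d.-1 * j).
Proof.
move=> B1 P_le [g [g_gen ->]]; have B0 := le_trans ler01 B1.
rewrite rmorph_prod /= (absv_prod av) exprM -[in leRHS](card_ord j) -prodr_const.
apply: ler_prod => l _; rewrite (absv_ge0 av) /=.
have [i [k [e [_ /andP[_ e_le] ->]]]] := g_gen l.
rewrite rmorphXn /= (absvX av) meval_lift_iter.
apply: le_trans (_ : B ^+ e <= _); last exact: ler_weXn2l.
by rewrite lerXn2r ?nnegrE ?absv_ge0.
Qed.

(** The exponent d (N + 1) bounds both the degree of the cofactor eta and, when
n < d (N + 1), the degree of the monomials that form the basis. *)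
Lemma special_basis_absv_le (B : R) n c (H : 'I_c -> {mpoly K[N.+1]}) J P j :
  (0 < d)%N -> 1 <= B -> (forall k i, v (iter k FK P i) <= B) ->
  special_basis F v I d n H ->
  log_base ((2 * N + 2)%:R / (2 * N + 1)%:R) n%:R < J.+1%:R :> R ->
  v (H j).@[P] <= ((d * N.+1) ^ N.+1)%N%:R * B ^+ (d * N.+1 + d.-1 * J).
Proof.
move=> d_gt0 B1 P_le [_ H_special] t2_lt; have B0 := le_trans ler01 B1.
have D_gt0 : (0 < d * N.+1)%N by rewrite muln_gt0 d_gt0.
case: ifPn H_special => [_|]; last first.
  rewrite -ltnNge => n_lt /(_ j)[m m_deg ->].
  apply: le_trans (absv_monomial_le av m (P_le 0)) _; rewrite -[leLHS]mul1r.
  rewrite ler_pM ?exprn_ge0// ?ler1n ?expn_gt0 ?D_gt0//.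
  by rewrite ler_weXn2l// m_deg (leq_trans (ltnW n_lt)) ?leq_addr.
move=> /(_ j)[k [e [eta [G [/andP[_ k_le] G_prod [e_lt eta_homog] eta_le ->]]]]].
rewrite mevalM (absvM av) exprD mulrA.
rewrite ler_pM ?absv_ge0//; last first.
  apply: le_trans (gen_products_absv_le B1 P_le G_prod) _.
  rewrite ler_weXn2l// leq_mul2l -ltnS -(ltr_nat R).
  by move: k_le; rewrite floor_ge_int => /le_lt_trans -> //; rewrite orbT.
apply: le_trans (absv_form_le av B0 eta_homog eta_le (P_le 0)) _.
rewrite ler_pM ?exprn_ge0// ?ler_weXn2l// 1?ltnW//.
by rewrite ler_nat leq_exp2r.
Qed.

End Dynamics.

(** A linear relation between the polynomials gives one between the sections, so
the basis elements are independent already as forms on the whole space. *)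
Lemma special_basis_size_le (R : realType) (K : fieldType) (v : K -> R) N d I
    (F : (N.+1).-tuple {mpoly K[N.+1]}) n c (H : 'I_c -> {mpoly K[N.+1]}) :
  idealr_closed I -> special_basis F v I d n H -> (c <= n.+1 ^ N.+1)%N.
Proof.
move=> [I0 _ _] [[H_homog H_free _] _]; apply: free_forms_leq H_homog _.
move=> a aH0; apply: H_free => i; exists 0.
by rewrite /= aH0 subrr mulr0.
Qed.

(** * The logarithmic bound *)

(** The three terms come from log c, from the cofactors of bounded degree and from
the products of generators.  The division by log 2 is there because constants
are compared with log n, which is at least log 2. *)
Definition log_det_const (R : realType) (d N : nat) : R :=
  (2 * N.+1)%:R + (ln ((d * N.+1) ^ N.+1)%N%:R + (d * N.+1)%:R) / ln 2
  + d.-1%:R / ln ((2 * N + 2)%:R / (2 * N + 1)%:R).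

Lemma log_det_const_gt0 (R : realType) (d N : nat) :
  (0 < d)%N -> 0 < log_det_const R d N.
Proof.
move=> d_gt0; rewrite /log_det_const -addrA ltr_pwDl ?ltr0n//.
rewrite addr_ge0 ?divr_ge0 ?addr_ge0 ?ler0n//.
- by rewrite ln_ge0// ler1n expn_gt0 muln_gt0 d_gt0.
- by rewrite ln_ge0// ler1n.
- rewrite ln_ge0// ler_pdivlMr; last by rewrite ltr0n addn1.
  by rewrite mul1r ler_nat leq_add2l.
Qed.

(** Here D is the absolute value of the determinant, B bounds the coordinates of
the points and m is max(log R, 1). *)
Lemma ln_det_bound (R : realType) (N d n c J : nat) (m B D : R) :
  (2 <= n)%N -> (0 < c)%N -> (c <= n.+1 ^ N.+1)%N -> (0 < d)%N ->
  1 <= m -> 1 <= B -> ln B <= m -> 0 < D ->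
  J%:R <= ln n%:R / ln ((2 * N + 2)%:R / (2 * N + 1)%:R) :> R ->
  D <= (c ^ c)%N%:R *
    (((d * N.+1) ^ N.+1)%N%:R * B ^+ (d * N.+1 + d.-1 * J)) ^+ c ->
  ln D <= log_det_const R d N * m * ln n%:R * c%:R.
Proof.
move=> n2 c_gt0 c_le d_gt0 m1 B1 lnB_le D0 J_le D_le; rewrite /log_det_const.
have m0 : 0 <= m by exact: le_trans ler01 m1.
have B0 : 0 < B by exact: lt_le_trans ltr01 B1.
have D_gt0 : (0 < (d * N.+1) ^ N.+1)%N by rewrite expn_gt0 muln_gt0 d_gt0.
set A : R := ((d * N.+1) ^ N.+1)%N%:R in D_le *.
have A1 : 1 <= A by rewrite ler1n.
have A0 : 0 < A by exact: lt_le_trans ltr01 A1.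
set E := (d * N.+1 + d.-1 * J)%N in D_le *.
have c0 : 0 < c%:R :> R by rewrite ltr0n.
have ln2_gt0 : 0 < ln 2 :> R by rewrite ln_gt0// ltr1n.
have lnn_ge : ln 2 <= ln n%:R :> R.
  by rewrite ler_ln ?posrE ?ltr0n ?ler_nat// (leq_trans _ n2).
have lnc_le : ln c%:R <= (2 * N.+1)%:R * ln n%:R :> R.
  rewrite mulr_natl -lnXn ?ltr0n ?(leq_trans _ n2)//.
  rewrite -natrX ler_ln ?posrE ?ltr0n// ?expn_gt0 ?(leq_trans _ n2)//.
  rewrite ler_nat (leq_trans c_le)// expnM leq_exp2r//.
  (* n + 1 <= n ^ 2, whence the factor 2 in the constant *)
  apply: (@leq_trans (n * 2)); last by rewrite -mulnn leq_mul2l n2 orbT.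
  by rewrite muln2 -addnn -addn1 leq_add2l ltnW.
have lnD_le : ln D <= c%:R * (ln c%:R + (ln A + E%:R * ln B)).
  have pos : 0 < A * B ^+ E by rewrite mulr_gt0// exprn_gt0.
  apply: le_trans (_ : _ <= ln ((c ^ c)%N%:R * (A * B ^+ E) ^+ c)) _.
    rewrite ler_ln// posrE mulr_gt0 ?exprn_gt0// ltr0n expn_gt0 c_gt0//.
  rewrite lnM ?posrE ?exprn_gt0 ?ltr0n ?expn_gt0 ?c_gt0//.
  rewrite natrX !lnXn// lnM ?posrE ?exprn_gt0// lnXn//.
  by rewrite mulrDr !mulr_natl.
apply: le_trans lnD_le _; rewrite [leRHS]mulrC ler_wpM2l ?ler0n//.
set L := ln n%:R in lnn_ge lnc_le J_le *.
set q := ln (_ / _) in J_le *.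
have L0 : 0 <= L by rewrite (le_trans (ltW ln2_gt0)).
have const_le a : 0 <= a -> a <= a / ln 2 * L.
  by move=> a0; rewrite mulrAC -mulrA ler_peMr// ler_pdivlMr// mul1r.
have lnA_le : ln A <= ln A / ln 2 * L by apply: const_le; rewrite ln_ge0.
have D_le' : (d * N.+1)%:R <= (d * N.+1)%:R / ln 2 * L :> R by apply: const_le.
have E_le : E%:R <= ((d * N.+1)%:R / ln 2 + d.-1%:R / q) * L.
  rewrite natrD mulrDl lerD// natrM mulrAC -mulrA ler_wpM2l//.
have lnB0 : 0 <= ln B by rewrite ln_ge0.
have EB_le : E%:R * ln B <= ((d * N.+1)%:R / ln 2 + d.-1%:R / q) * L * m.
  by rewrite ler_pM.
have lnA0 : 0 <= ln A by rewrite ln_ge0.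
have le_m x : 0 <= x -> x <= x * m by move=> ?; rewrite ler_peMr.
have := le_m _ (le_trans lnA0 lnA_le); have := le_m ((2 * N.+1)%:R * L).
rewrite mulr_ge0// => /(_ isT) h1 h2.
move: (le_trans lnc_le h1) (le_trans lnA_le h2) EB_le.
lra.
Qed.

Theorem theorem3p1 (R : realType) (d N : nat) (hd : (2 <= d)%N) :
  exists C : R,
  forall (K : fieldType) (v : K -> R) (I : {pred {mpoly K[N.+1]}})
         (F : (N.+1).-tuple {mpoly K[N.+1]}),
  absolute_value v ->
  polarized_system F d I ->
  proj_dim_ge I 1 ->
  forall n : nat, (2 <= n)%N ->
  forall (c : nat) (H : 'I_c -> {mpoly K[N.+1]}),
  special_basis F v I d n H ->
  forall P : 'I_c -> 'I_N.+1 -> K,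
  (forall i, (filled_julia F v `&` punctured_cone I idfun) (P i)) ->
  (lne (v (\det (\matrix_(i < c, j < c) (H j).@[P i])))%:E
   <= C%:E * maxe (lne (diameter v (filled_julia F v
                                     `&` punctured_cone I idfun))) 1
      * (ln (n%:R : R))%:E * (c%:R : R)%:E)%E.
Proof.
set q : R := (2 * N + 2)%:R / (2 * N + 1)%:R.
have q_gt1 : 1 < q.
  by rewrite ltr_pdivlMr ?mul1r ?ltr_nat ?ltn_add2l// ltr0n addn1.
have lnq_gt0 : 0 < ln q by rewrite ln_gt0.
have d_gt0 : (0 < d)%N by exact: ltnW.
exists (log_det_const R d N) => K v I F av psF _ n n2 c H H_special P P_jc.
have C_gt0 := log_det_const_gt0 R N d_gt0.
case: c => [|c'] in H H_special P P_jc *.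
  by rewrite det_mx00 (absv1 av) lne1 mule0.
set c := c'.+1 in H H_special P P_jc *.
have lnn_gt0 : 0 < ln n%:R :> R by rewrite ln_gt0// ltr1n.
set JC := _ `&` _ in P_jc *; set D := v _.
have diam_ge0 : (0 <= diameter v JC)%E.
  apply: ereal_sup_ubound; exists (P ord0) => //; exists (P ord0) => //.
  congr (_%:E); apply/eqP; rewrite eq_le; apply/andP; split.
    by apply/bigmax_leP; split=> // i _; rewrite subrr (absv0 av).
  exact: bigmax_ge_id.
have [D0|D_gt0] := leP D 0; first by rewrite le0_lneNy ?leNye ?lee_fin.
rewrite lne_EFin//.
(* if the set is unbounded the right-hand side is +oo, as c > 0 *)
case diamE : (diameter v JC) diam_ge0 => [r| |] // _; last first.
  rewrite (_ : maxe _ _ = +oo%E); last by rewrite /= maxye.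
  by rewrite gt0_muley ?lte_fin// !gt0_mulye ?lte_fin ?ltr0n// leey.
set B := Num.max 1 r; have B1 : 1 <= B by rewrite le_max lexx.
have [m [maxE m1 lnB_le]] : exists m : R,
    [/\ maxe (lne r%:E) 1%E = m%:E, 1 <= m & ln B <= m].
  have [r_le0|r_gt0] := leP r 0.
    exists 1; rewrite le0_lneNy ?lee_fin// maxNye; split=> //.
    by rewrite /B max_l ?ln1// (le_trans r_le0).
  exists (Num.max (ln r) 1); rewrite lne_EFin// EFin_max; split => //.
    by rewrite le_max lexx orbT.
  rewrite /B; have [r_gt1|r_le1] := ltP 1 r; first by rewrite le_max lexx.
  by rewrite ln1 le_max ler01 orbT.
rewrite maxE -!EFinM lee_fin.
have [[I_ideal _ _ _] _ _] := psF.
pose t2 : R := log_base q n%:R; pose J := Num.truncn t2.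
have t2_ge0 : 0 <= t2 by rewrite divr_ge0// ltW.
have /andP[J_le J_gt] := truncn_itv t2_ge0.
apply: (ln_det_bound (B := B) (J := J)) => //.
  exact: special_basis_size_le I_ideal H_special.
apply: (absv_det_le av).
  by rewrite mulr_ge0// exprn_ge0// (le_trans ler01).
move=> i j; rewrite mxE.
apply: (special_basis_absv_le av _ d_gt0 B1 _ H_special J_gt) => k l.
apply: (julia_cone_absv_le av psF) diamE _.
by apply: (julia_cone_iter psF); exact: P_jc.
Qed.
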